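(* Let $R$ be a countable unital ring such that the right $R$-module $R^\omega$ is flat and Mittag--Leffler, and let $\iota:R^{(\omega)}\to R^\omega$ denote the pure inclusion. Then a right $R$-module $M$ is cotorsion if and only if the map $\mathrm{Hom}_R(\iota,M):\mathrm{Hom}_R(R^\omega,M)\to\mathrm{Hom}_R(R^{(\omega)},M)$ is surjective.
   Context: Rings are associative; modules are (unitary) right $R$-modules. $R^\omega$ is the direct product and $R^{(\omega)}$ the direct sum of countably infinitely many copies of the right module $R$ (indexed by $\omega$). A module is pure-projective if it is a direct summand in a direct sum of finitely presented modules. A module $M$ is Mittag--Leffler if each finite subset of $M$ is contained in a pure-projective submodule of $M$ which is pure in $M$. A module $M$ is cotorsion if $\mathrm{Ext}^1_R(F,M)=0$ for every flat module $F$. *)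

(* Defs.v *)
From HB Require Import structures.
From mathcomp Require Import all_boot all_algebra all_classical.

Set Implicit Arguments.
Unset Strict Implicit.
Unset Printing Implicit Defensive.

Import GRing.Theory.

Local Open Scope classical_set_scope.
Local Open Scope quotient_scope.
Local Open Scope ring_scope.

(* Right R-modules are left modules over the converse ring R^c, so that
   (r : R^c) *: x stands for x r.  Rings are unital and may be zero. *)

Section Tensor.
Variables (R : pzRingType) (F : lmodType R^c) (A : lmodType R).

(* The tensor product of a right module F and a left module A consists of the
   formal sums of pairs (x, a), written as sequences, modulo the least
   congruence for concatenation that makes the classes of the pairs biadditive
   and R-balanced.  In the presence of teq_addl, teq_0l provides opposites. *)
Inductive tensor_eq : seq (F * A) -> seq (F * A) -> Prop :=
| teq_refl s : tensor_eq s s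
| teq_sym s t : tensor_eq s t -> tensor_eq t s
| teq_trans s t u : tensor_eq s t -> tensor_eq t u -> tensor_eq s u
| teq_cat s s' t t' :
    tensor_eq s s' -> tensor_eq t t' -> tensor_eq (s ++ t) (s' ++ t')
| teq_catC s t : tensor_eq (s ++ t) (t ++ s)
| teq_0l a : tensor_eq [:: (0, a)] [::]
| teq_addl x y a : tensor_eq [:: (x + y, a)] [:: (x, a); (y, a)]
| teq_addr x a b : tensor_eq [:: (x, a + b)] [:: (x, a); (x, b)]
| teq_bal (r : R) x a : tensor_eq [:: ((r : R^c) *: x, a)] [:: (x, r *: a)].

Definition tensor_eqb (s t : seq (F * A)) : bool := `[< tensor_eq s t >].

Lemma tensor_eqb_equiv : equiv_class_of tensor_eqb.
Proof.
split.
- by move=> s; apply/asboolP; apply: teq_refl.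
- by move=> s t; apply/asboolP/asboolP; apply: teq_sym.
- move=> t s u /asboolP st /asboolP tu; apply/asboolP.
  exact: teq_trans st tu.
Qed.

Canonical tensor_equiv := EquivRelPack tensor_eqb_equiv.

Definition tensor : Type := {eq_quot tensor_equiv}.

HB.instance Definition _ := Choice.on tensor.
HB.instance Definition _ := EqQuotient.on tensor.

Definition tensor_class (s : seq (F * A)) : tensor := \pi_tensor s.

Lemma tensor_classP s t : tensor_class s = tensor_class t <-> tensor_eq s t.
Proof.
split=> [/eqmodP/asboolP //|st].
by apply/eqmodP/asboolP.
Qed.

Lemma tensor_classK (u : tensor) : tensor_class (repr u) = u.
Proof. exact: reprK. Qed.

Lemma tensor_repr s : tensor_eq (repr (tensor_class s)) s.
Proof. by apply/tensor_classP; rewrite tensor_classK. Qed.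

Definition tensor_add (u v : tensor) : tensor :=
  tensor_class (repr u ++ repr v).

Definition tensor_opp (u : tensor) : tensor :=
  tensor_class [seq (- p.1, p.2) | p <- repr u].

Lemma tensor_addE s t :
  tensor_add (tensor_class s) (tensor_class t) = tensor_class (s ++ t).
Proof. by apply/tensor_classP; apply: teq_cat; apply: tensor_repr. Qed.

Lemma tensor_addA : associative tensor_add.
Proof.
move=> u v w.
rewrite -(tensor_classK u) -(tensor_classK v) -(tensor_classK w).
by rewrite !tensor_addE catA.
Qed.

Lemma tensor_addC : commutative tensor_add.
Proof. by move=> u v; apply/tensor_classP; apply: teq_catC. Qed.

Lemma tensor_add0 : left_id (tensor_class [::]) tensor_add.
Proof. by move=> u; rewrite -{1}(tensor_classK u) tensor_addE tensor_classK. Qed.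

Lemma tensor_addN : left_inverse (tensor_class [::]) tensor_opp tensor_add.
Proof.
move=> u; rewrite -{2}(tensor_classK u) tensor_addE; apply/tensor_classP.
elim: (repr u) => [|[x a] s IHs] /=; first exact: teq_refl.
set s' := map _ s in IHs *.
apply: (@teq_trans _ ((s' ++ [:: (x, a)] ++ s) ++ [:: (- x, a)])).
  exact: (teq_catC [:: (- x, a)] (s' ++ [:: (x, a)] ++ s)).
rewrite -!catA.
apply: (@teq_trans _ (s' ++ s ++ [:: (- x, a)] ++ [:: (x, a)])).
  apply: teq_cat (teq_refl _) _; rewrite (catA s).
  exact: (teq_catC [:: (x, a)] (s ++ [:: (- x, a)])).
rewrite catA -[X in tensor_eq _ X]/([::] ++ [::] : seq (F * A)).
apply: teq_cat IHs _; apply: teq_trans (teq_0l a).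
by apply: teq_sym; rewrite -(addNr x); apply: teq_addl.
Qed.

HB.instance Definition _ :=
  GRing.isZmodule.Build tensor tensor_addA tensor_addC tensor_add0 tensor_addN.

Definition tens (x : F) (a : A) : tensor := tensor_class [:: (x, a)].

Lemma tensor_class_cat s t :
  tensor_class (s ++ t) = tensor_class s + tensor_class t.
Proof. by rewrite -tensor_addE. Qed.

Lemma tensor_classE s : tensor_class s = \sum_(p <- s) tens p.1 p.2.
Proof.
elim: s => [|[x a] s IHs]; first by rewrite big_nil.
by rewrite big_cons -IHs -tensor_class_cat.
Qed.

Lemma tensDl x y a : tens (x + y) a = tens x a + tens y a.
Proof.
by rewrite /tens -tensor_class_cat; apply/tensor_classP; apply: teq_addl.
Qed.

Lemma tensDr x a b : tens x (a + b) = tens x a + tens x b.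
Proof.
by rewrite /tens -tensor_class_cat; apply/tensor_classP; apply: teq_addr.
Qed.

Lemma tens_bal (r : R) x a : tens ((r : R^c) *: x) a = tens x (r *: a).
Proof. by apply/tensor_classP; apply: teq_bal. Qed.

Definition balanced (V : zmodType) (b : F -> A -> V) : Prop :=
  [/\ forall x y a, b (x + y) a = b x a + b y a,
      forall x a a', b x (a + a') = b x a + b x a' &
      forall (r : R) x a, b ((r : R^c) *: x) a = b x (r *: a)].

Definition tensor_lift (V : zmodType) (b : F -> A -> V) (u : tensor) : V :=
  \sum_(p <- repr u) b p.1 p.2.

Section Lift.
Variables (V : zmodType) (b : F -> A -> V).
Hypothesis b_bal : balanced b.

Lemma tensor_lift_class s :
  tensor_lift b (tensor_class s) = \sum_(p <- s) b p.1 p.2.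
Proof.
case: b_bal => bDl bDr bZ; suff teq_sum t u : tensor_eq t u ->
    \sum_(p <- t) b p.1 p.2 = \sum_(p <- u) b p.1 p.2.
  exact/teq_sum/tensor_repr.
elim=> //.
- by move=> {}t {}u v _ -> _ ->.
- by move=> {}t t' {}u u' _ IH _ IH'; rewrite !big_cat IH IH'.
- by move=> {}t {}u; rewrite !big_cat /= addrC.
- move=> a; rewrite big_seq1 big_nil /=.
  by apply: (@addrI _ (b 0 a)); rewrite -bDl !addr0.
- by move=> x y a; rewrite !big_cons !big_nil !addr0 bDl.
- by move=> x a a'; rewrite !big_cons !big_nil !addr0 bDr.
- by move=> r x a; rewrite !big_seq1 bZ.
Qed.

Lemma tensor_lift_tens x a : tensor_lift b (tens x a) = b x a.
Proof. by rewrite tensor_lift_class big_seq1. Qed.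

Lemma tensor_liftD : {morph tensor_lift b : u v / u + v}.
Proof.
move=> u v; rewrite -(tensor_classK u) -(tensor_classK v) -tensor_class_cat.
by rewrite !tensor_lift_class big_cat.
Qed.

Lemma tensor_lift_uniq (h : {additive tensor -> V}) :
  (forall x a, h (tens x a) = b x a) -> h =1 tensor_lift b.
Proof.
move=> hb u; rewrite -(tensor_classK u) tensor_lift_class tensor_classE.
by rewrite raddf_sum; apply: eq_bigr => p _; apply: hb.
Qed.

End Lift.
End Tensor.

Section TensorMap.
Variables (R : pzRingType) (F G : lmodType R^c) (A B : lmodType R).
Variables (f : {linear F -> G}) (g : {linear A -> B}).

Definition tensor_map : tensor F A -> tensor G B :=
  tensor_lift (fun x a => tens (f x) (g a)).

Lemma tensor_map_balanced : balanced (fun x a => tens (f x) (g a)).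
Proof.
split=> [x y a|x a a'|r x a].
- by rewrite linearD tensDl.
- by rewrite linearD tensDr.
- by rewrite !linearZ tens_bal.
Qed.

Lemma tensor_map_tens x a : tensor_map (tens x a) = tens (f x) (g a).
Proof. exact/tensor_lift_tens/tensor_map_balanced. Qed.

Lemma tensor_map_class s :
  tensor_map (tensor_class s) = tensor_class [seq (f p.1, g p.2) | p <- s].
Proof.
rewrite /tensor_map tensor_lift_class; last exact: tensor_map_balanced.
by rewrite tensor_classE big_map.
Qed.

Lemma tensor_mapD : {morph tensor_map : u v / u + v}.
Proof. exact/tensor_liftD/tensor_map_balanced. Qed.

End TensorMap.

Definition flat (R : pzRingType) (F : lmodType R^c) : Prop :=
  forall (A B : lmodType R) (g : {linear A -> B}),
    injective g -> injective (tensor_map (@idfun F) g).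

(* The embedding f : N -> M is pure, i.e., its image is a pure submodule. *)
Definition pure_mono (R : pzRingType) (N M : lmodType R^c)
    (f : {linear N -> M}) : Prop :=
  injective f /\
  forall A : lmodType R, injective (tensor_map f (@idfun A)).

Section DirectProduct.
Variables (S : pzRingType) (I : Type) (N : I -> lmodType S).

Definition dprod : Type := forall i, N i.

HB.instance Definition _ := Choice.on dprod.

Definition dprod_zero : dprod := fun i => 0.
Definition dprod_add (f g : dprod) : dprod := fun i => f i + g i.
Definition dprod_opp (f : dprod) : dprod := fun i => - f i.
Definition dprod_scale (r : S) (f : dprod) : dprod := fun i => r *: f i.

Lemma dprod_addA : associative dprod_add.
Proof. by move=> f g h; apply: functional_extensionality_dep => i; apply: addrA. Qed.

Lemma dprod_addC : commutative dprod_add.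
Proof. by move=> f g; apply: functional_extensionality_dep => i; apply: addrC. Qed.

Lemma dprod_add0 : left_id dprod_zero dprod_add.
Proof. by move=> f; apply: functional_extensionality_dep => i; apply: add0r. Qed.

Lemma dprod_addN : left_inverse dprod_zero dprod_opp dprod_add.
Proof. by move=> f; apply: functional_extensionality_dep => i; apply: addNr. Qed.

HB.instance Definition _ :=
  GRing.isZmodule.Build dprod dprod_addA dprod_addC dprod_add0 dprod_addN.

Lemma dprod_scaleA r s f :
  dprod_scale r (dprod_scale s f) = dprod_scale (r * s) f.
Proof. by apply: functional_extensionality_dep => i; apply: scalerA. Qed.

Lemma dprod_scale1 : left_id 1 dprod_scale.
Proof. by move=> f; apply: functional_extensionality_dep => i; apply: scale1r. Qed.

Lemma dprod_scaleDr : right_distributive dprod_scale +%R.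
Proof. by move=> r f g; apply: functional_extensionality_dep => i; apply: scalerDr. Qed.

Lemma dprod_scaleDl f : {morph dprod_scale^~ f : r s / r + s}.
Proof. by move=> r s; apply: functional_extensionality_dep => i; apply: scalerDl. Qed.

HB.instance Definition _ := GRing.Zmodule_isLmodule.Build S dprod
  dprod_scaleA dprod_scale1 dprod_scaleDr dprod_scaleDl.

Definition finsupp : {pred dprod} :=
  fun f => `[< finite_set [set i | f i <> 0] >].

Lemma finsupp_closed : submod_closed finsupp.
Proof.
split=> [|r f g /asboolP ff /asboolP gg]; apply/asboolP.
  by rewrite [X in finite_set X](_ : _ = set0)// -subset0 => i /=; apply.
apply: (@sub_finite_set _ _ ([set i | f i <> 0] `|` [set i | g i <> 0])).
  move=> i /= rfg0; have [fi0|] := pselect (f i = 0); last by left.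
  right=> gi0; apply: rfg0; rewrite -[LHS]/(r *: f i + g i).
  by rewrite fi0 gi0 scaler0 addr0.
by rewrite finite_setU.
Qed.

HB.instance Definition _ := GRing.isSubmodClosed.Build S dprod finsupp
  finsupp_closed.

Record dsum : Type := DSum { dsum_val :> dprod; _ : dsum_val \in finsupp }.

HB.instance Definition _ := [isSub for dsum_val].
HB.instance Definition _ := [Choice of dsum by <:].
HB.instance Definition _ := [SubChoice_isSubLmodule of dsum by <:].

Definition dsum_incl : {linear dsum -> dprod} := val.

End DirectProduct.

(* F is the cokernel of a map of free modules of finite rank. *)
Definition finitely_presented (R : pzRingType) (M : lmodType R^c) : Prop :=
  exists m n (d : {linear 'rV[R^c]_m -> 'rV[R^c]_n})
    (p : {linear 'rV[R^c]_n -> M}),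
    (forall y, exists x, p x = y) /\
    (forall x, p x = 0 <-> exists z, d z = x).

Definition pure_projective (R : pzRingType) (M : lmodType R^c) : Prop :=
  exists (I : Type) (N : I -> lmodType R^c),
    (forall i, finitely_presented (N i)) /\
    exists (M' : lmodType R^c) (f : {linear (M * M')%type -> dsum N}),
      bijective f.

Definition mittag_leffler (R : pzRingType) (M : lmodType R^c) : Prop :=
  forall s : seq M, exists (N : lmodType R^c) (f : {linear N -> M}),
    [/\ pure_projective N, pure_mono f &
        forall x, x \in s -> exists y, f y = x].

(* Yoneda's Ext^1(F, M): the extensions 0 -> M -> E -> F -> 0 up to
   equivalence, whose zero element is the class of the direct sum M * F. *)
Section Ext1.
Variables (R : pzRingType) (F M : lmodType R^c).

Record extension : Type := Extension {
  ext_mod : lmodType R^c;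
  ext_in : {linear M -> ext_mod};
  ext_pr : {linear ext_mod -> F};
  ext_in_inj : injective ext_in;
  ext_pr_surj : forall y, exists x, ext_pr x = y;
  ext_exact : forall x, ext_pr x = 0 <-> exists z, ext_in z = x }.

Definition ext_equiv (E E' : extension) : Prop :=
  exists h : {linear ext_mod E -> ext_mod E'},
    [/\ bijective h, forall z, h (ext_in E z) = ext_in E' z &
        forall x, ext_pr E' (h x) = ext_pr E x].

Definition trivial_in (z : M) : (M * F)%type := (z, 0).

Lemma trivial_in_linear : linear trivial_in.
Proof. by move=> r x y; apply/pair_equal_spec; rewrite /= scaler0 addr0. Qed.

HB.instance Definition _ :=
  GRing.isLinear.Build _ _ _ _ trivial_in trivial_in_linear.

Lemma trivial_in_inj : injective trivial_in.
Proof. by move=> x y []. Qed.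

Lemma trivial_pr_surj (y : F) : exists x : (M * F)%type, x.2 = y.
Proof. by exists (0, y). Qed.

Lemma trivial_exact (x : (M * F)%type) :
  x.2 = 0 <-> exists z, trivial_in z = x.
Proof.
by case: x => z y /=; split=> [->|[z' []] //]; exists z.
Qed.

Definition trivial_ext : extension :=
  @Extension (M * F)%type trivial_in snd
    trivial_in_inj trivial_pr_surj trivial_exact.

Definition Ext1_eq0 : Prop := forall E : extension, ext_equiv E trivial_ext.

End Ext1.

Definition cotorsion (R : pzRingType) (M : lmodType R^c) : Prop :=
  forall F : lmodType R^c, flat F -> Ext1_eq0 F M.

Definition Romega (R : pzRingType) : lmodType R^c :=
  dprod (fun _ : nat => (R^c)^o : lmodType R^c).

Definition Rsum (R : pzRingType) : lmodType R^c :=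
  dsum (fun _ : nat => (R^c)^o : lmodType R^c).

Definition iota_incl (R : pzRingType) : {linear Rsum R -> Romega R} :=
  dsum_incl (fun _ : nat => (R^c)^o : lmodType R^c).

(* Hom_R(f, M) : Hom_R(V, M) -> Hom_R(U, M). *)
Definition Hom_map (R : pzRingType) (U V : lmodType R^c) (f : {linear U -> V})
    (M : lmodType R^c) (h : {linear V -> M}) : {linear U -> M} := h \o f.

(* Equality in Hom_R(U, V) is pointwise. *)
Lemma linear_eqP (R : pzRingType) (U V : lmodType R^c) (f g : {linear U -> V}) :
  f = g <-> f =1 g.
Proof.
split=> [-> //|]; case: f g => f cf [g cg] /= fg.
have {fg} fg : f = g by apply: functional_extensionality_dep.
case: g / fg cg => cg; congr GRing.Linear.Pack.
case: cf cg => [[a] [b]] [[a'] [b']].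
by rewrite (Prop_irrelevance a a') (Prop_irrelevance b b').
Qed.

(* Main.v *)
Require Import Defs.
From HB Require Import structures.
From mathcomp Require Import all_boot all_algebra all_classical.
From mathcomp Require Import ring_quotient.
Import GRing.Theory.
Local Open Scope classical_set_scope.
Local Open Scope quotient_scope.
Local Open Scope ring_scope.
Set Implicit Arguments.
Unset Strict Implicit.
Unset Printing Implicit Defensive.

(** A module M is cotorsion if and only if linear maps from the direct sum of
countably many copies of R to M extend to the direct product.

If M is cotorsion, the extension property holds because the quotient of the
product by the direct sum is flat ([flat_quot]): an element of a tensor product
with the direct sum is killed by dropping finitely many coordinates, an
operation that does not change the class modulo the direct sum.  Pushing out
the sum-product sequence along a given map to M yields an extension of this
flat quotient by M, and a splitting of it is an extension of the map
([Ext1_eq0_extend]).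

Conversely, suppose that maps to M extend, and let 0 -> M -> E -> F -> 0 be
exact with F flat.  Consider the submodules T of E that meet M trivially and
whose image in F is pure.  By Zorn's lemma there is a maximal one, and it has
to map onto F, which splits the extension ([section_total]).  Indeed, passing
to the quotients of E by T and of F by the image of T, which is again flat, it
suffices to find one such T whose image contains a given element of F
([pure_section_at]).  As R is countable, a countable bookkeeping based on the
equational criterion for flatness places the element in the image of the limit
of a sequence of free modules L --b_0--> L --b_1--> L --> ... with maps
v_n : L -> F, such that the limit embeds in F as a pure submodule
([bass_sequence]).  Lift each v_n to w_n : L -> E.  The maps
d_n = w_n - w_(n+1) b_n take values in M, and correcting the lifts into a
compatible family amounts to solving z_n = z_(n+1) b_n + d_n for maps
z_n : L -> M.  The formal solution
z_n = d_n + d_(n+1) b_n + d_(n+2) b_(n+1) b_n + ...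
is an infinite sum in M, but makes sense in the direct product if the d_n are
replaced by the canonical basis; applying the extension to the product of the
map that sends this basis to the d_n gives a solution in M ([telescope]).

The free modules L are all taken equal to the direct sum of countably many
copies of R, so that the transition maps are endomorphisms of one module.  The
equational criterion and purity are stated for a single equation, which is all
that the argument needs. *)

(** * Quotients of groups and modules *)

(** Subgroups of an abelian group, as propositional predicates. *)
Record subgroup (V : zmodType) : Type := Subgroup {
  subgroup_set :> V -> Prop;
  subgroup0 : subgroup_set 0;
  subgroupB : forall x y, subgroup_set x -> subgroup_set y ->
    subgroup_set (x - y) }.

Section SubgroupTheory.
Variables (V : zmodType) (I : subgroup V).

Lemma subgroupN x : I x -> I (- x).
Proof.
by move=> Ix; rewrite -sub0r; apply: subgroupB => //; apply: subgroup0.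
Qed.

Lemma subgroupD x y : I x -> I y -> I (x + y).
Proof.
by move=> Ix Iy; rewrite -[y]opprK; apply: subgroupB => //; apply: subgroupN.
Qed.

Definition subgroup_pred : {pred V} := fun x => `[<I x>].

Lemma subgroup_zmod_closed : zmod_closed subgroup_pred.
Proof.
split=> [|x y /asboolP Ix /asboolP Iy]; apply/asboolP; first exact: subgroup0.
exact: subgroupB.
Qed.
HB.instance Definition _ := GRing.isZmodClosed.Build V subgroup_pred
  subgroup_zmod_closed.

(** The quotient of V by the subgroup I. *)
Definition quot_group : Type := Quotient.quot subgroup_pred.

HB.instance Definition _ := EqQuotient.on quot_group.
HB.instance Definition _ := GRing.Zmodule.on quot_group.

Definition group_pi (x : V) : quot_group := \pi_quot_group x.

Lemma group_piK (u : quot_group) : group_pi (repr u) = u.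
Proof. exact: reprK. Qed.

Lemma group_pi_eqE x y : group_pi x = group_pi y <-> I (x - y).
Proof.
have := Quotient.idealrBE subgroup_pred x y.
by move=> h; split=> [/eqP|/asboolP xy]; [|apply/eqP; move: xy];
   rewrite [(_ == _)](esym h) => // /asboolP.
Qed.

Lemma group_pi_zmod_morphism : zmod_morphism group_pi.
Proof. by move=> x y; rewrite /group_pi !piE. Qed.
HB.instance Definition _ :=
  GRing.isZmodMorphism.Build V quot_group group_pi group_pi_zmod_morphism.

Lemma group_pi_eq0 x : group_pi x = 0 <-> I x.
Proof. by rewrite -(raddf0 group_pi) group_pi_eqE subr0. Qed.

End SubgroupTheory.

(** Submodules, as the subgroups stable under scaling. *)
Record submodule (S : pzRingType) (V : lmodType S) : Type := Submodule {
  submod_group :> subgroup V;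
  submodZ : forall r x, submod_group x -> submod_group (r *: x) }.

Section QuotientModule.
Variables (S : pzRingType) (V : lmodType S) (I : submodule V).

(** The quotient group, with the module structure that makes [quot_pi]
linear. *)
Definition quot_mod : Type := quot_group I.

HB.instance Definition _ := EqQuotient.on quot_mod.
HB.instance Definition _ := GRing.Zmodule.on quot_mod.

Definition quot_pi : V -> quot_mod := group_pi I.

Lemma quot_piK (u : quot_mod) : quot_pi (repr u) = u.
Proof. exact: group_piK. Qed.

Lemma quot_pi_eqE x y : quot_pi x = quot_pi y <-> I (x - y).
Proof. exact: group_pi_eqE. Qed.

HB.instance Definition _ :=
  GRing.isZmodMorphism.Build V quot_mod quot_pi (group_pi_zmod_morphism I).

Definition quot_scale (r : S) (u : quot_mod) : quot_mod :=
  quot_pi (r *: repr u).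

Lemma quot_pi_scale r x : quot_scale r (quot_pi x) = quot_pi (r *: x).
Proof.
apply/quot_pi_eqE; rewrite -scalerBr; apply: submodZ.
by apply/quot_pi_eqE; rewrite quot_piK.
Qed.

Lemma quot_scaleA r s u : quot_scale r (quot_scale s u) = quot_scale (r * s) u.
Proof. by rewrite -(quot_piK u) !quot_pi_scale scalerA. Qed.

Lemma quot_scale1 : left_id 1 quot_scale.
Proof. by move=> u; rewrite -(quot_piK u) quot_pi_scale scale1r. Qed.

Lemma quot_scaleDr : right_distributive quot_scale +%R.
Proof.
move=> r u v; rewrite -(quot_piK u) -(quot_piK v) -raddfD !quot_pi_scale.
by rewrite scalerDr raddfD.
Qed.

Lemma quot_scaleDl u : {morph quot_scale^~ u : r s / r + s}.
Proof.
by move=> r s; rewrite -(quot_piK u) !quot_pi_scale scalerDl raddfD.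
Qed.

HB.instance Definition _ := GRing.Zmodule_isLmodule.Build S quot_mod
  quot_scaleA quot_scale1 quot_scaleDr quot_scaleDl.

Lemma quot_pi_linear : scalable quot_pi.
Proof. by move=> r x; rewrite -quot_pi_scale. Qed.
HB.instance Definition _ :=
  GRing.isScalable.Build S V quot_mod *:%R quot_pi quot_pi_linear.

Lemma quot_pi_eq0 x : quot_pi x = 0 <-> I x.
Proof. by rewrite -(raddf0 quot_pi) quot_pi_eqE subr0. Qed.

Lemma quot_repr_pi x : I (repr (quot_pi x) - x).
Proof. by apply/quot_pi_eqE; rewrite quot_piK. Qed.

End QuotientModule.

Section QuotientLift.
Variables (S : pzRingType) (V W : lmodType S) (I : submodule V).
Variable f : {linear V -> W}.

(** The map induced on the quotient by I by a linear map that vanishes on I.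
The proof of vanishing is an argument so that linearity can be inferred. *)
Definition quot_lift (_ : forall x, I x -> f x = 0) (u : quot_mod I) : W :=
  f (repr u).

Hypothesis f0 : forall x, I x -> f x = 0.

Lemma quot_lift_pi x : quot_lift f0 (quot_pi I x) = f x.
Proof. by apply/subr0_eq; rewrite -linearB f0 //; apply: quot_repr_pi. Qed.

Lemma quot_lift_linear : linear (quot_lift f0).
Proof.
move=> r u v; rewrite -(quot_piK u) -(quot_piK v) -linearP !quot_lift_pi.
exact: linearP.
Qed.
HB.instance Definition _ :=
  GRing.isLinear.Build S (quot_mod I) W *:%R (quot_lift f0) quot_lift_linear.

End QuotientLift.

(** * Free modules of countable rank *)

Lemma big_nat_only (V : zmodType) (f : nat -> V) n i : (i < n)%N ->
  (forall j, j != i -> f j = 0) -> \sum_(0 <= j < n) f j = f i.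
Proof.
move=> ilt f0; rewrite (big_rem i) ?mem_index_iota //= big_seq big1 ?addr0 //.
by move=> j; rewrite mem_rem_uniq ?iota_uniq // inE => /andP[/f0].
Qed.

Section FreeModule.
Variable (S : pzRingType).

(** The direct product [Lprod] and the direct sum [Lfree] of countably many
copies of S; the latter is the free module of countable rank. *)
Definition Lprod : lmodType S := dprod (fun _ : nat => S^o : lmodType S).
Definition Lfree : lmodType S := dsum (fun _ : nat => S^o : lmodType S).

(** The coordinate of index i. *)
Definition coef (x : Lfree) (i : nat) : S :=
  dsum_val (x : dsum (fun _ : nat => S^o : lmodType S)) i.

Arguments coef : simpl never.

Lemma coefP r x y i : coef (r *: x + y) i = r * coef x i + coef y i.
Proof. by []. Qed.

Lemma Lfree_bound (x : Lfree) : exists N, forall i, (N <= i)%N -> coef x i = 0.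
Proof.
have /finite_seqP[s hs] : finite_set [set i | coef x i <> 0].
  by case: x => x hx; exact/asboolP/hx.
exists (\max_(i <- s) i).+1 => i hi; apply: contrapT => xi.
have : [set i | coef x i <> 0] i by [].
rewrite hs /= => si; move: hi; rewrite ltnNge => /negP; apply.
by rewrite (big_rem i) //= leq_maxl.
Qed.

(** Some bound such that the coordinates from that index on vanish. *)
Definition supp_bound (x : Lfree) : nat := projT1 (cid (Lfree_bound x)).

Lemma supp_boundP x i : (supp_bound x <= i)%N -> coef x i = 0.
Proof. by rewrite /supp_bound; case: (cid _) => N /=; apply. Qed.

Lemma Lfree_ofP (f : nat -> S) N : (forall i, (N <= i)%N -> f i = 0) ->
  exists x : Lfree, forall i, coef x i = f i.
Proof.
move=> fN.
have h : (f : Lprod) \in @finsupp S nat (fun _ : nat => S^o : lmodType S).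
  apply/asboolP; apply: (sub_finite_set _ (finite_II N)) => i /= fi0.
  by rewrite ltnNge; apply/negP => /fN.
by exists (@DSum S nat (fun _ : nat => S^o : lmodType S) _ h).
Qed.

Lemma LfreeP (x y : Lfree) : (forall i, coef x i = coef y i) -> x = y.
Proof. by move=> xy; apply/val_inj/functional_extensionality_dep. Qed.

(** The canonical basis of [Lfree], as elements of [Lprod] and of [Lfree]. *)
Definition delta (k : nat) : Lprod := fun i => (i == k)%:R.

Lemma delta_bound k i : (k.+1 <= i)%N -> delta k i = 0.
Proof. by rewrite /delta; case: ltngtP. Qed.

Definition ebase (k : nat) : Lfree := projT1 (cid (Lfree_ofP (@delta_bound k))).

Lemma ebaseE k i : coef (ebase k) i = (i == k)%:R.
Proof. by rewrite /ebase; case: (cid _) => y /= ->. Qed.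

Variable (F : lmodType S).
Implicit Type u : nat -> F.

(** The linear map on [Lfree] with prescribed values u on the basis. *)
Definition free_ext u (x : Lfree) : F :=
  \sum_(0 <= i < supp_bound x) coef x i *: u i.

Lemma free_extE u x N : (forall i, (N <= i)%N -> coef x i = 0) ->
  free_ext u x = \sum_(0 <= i < N) coef x i *: u i.
Proof.
move=> xN; rewrite /free_ext.
wlog: N xN / (supp_bound x <= N)%N => [wl|leN].
  rewrite (wl (maxn (supp_bound x) N)) ?leq_maxl //; last first.
    by move=> i; rewrite geq_max => /andP[_]; apply: xN.
  rewrite (@big_cat_nat _ _ _ N) ?leq_maxr //=.
  rewrite [X in _ + X]big_nat [X in _ + X]big1 ?addr0 // => i /andP[Ni _].
  by rewrite xN // scale0r.
rewrite [RHS](@big_cat_nat _ _ _ (supp_bound x)) //=.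
rewrite [X in _ + X]big_nat [X in _ + X]big1 ?addr0 // => i /andP[Ni _].
by rewrite supp_boundP // scale0r.
Qed.

Lemma free_ext_linear u : linear (free_ext u).
Proof.
move=> r x y; pose N := maxn (supp_bound x) (supp_bound y).
have Nx i : (N <= i)%N -> coef x i = 0.
  by rewrite geq_max => /andP[h _]; apply: supp_boundP.
have Ny i : (N <= i)%N -> coef y i = 0.
  by rewrite geq_max => /andP[_ h]; apply: supp_boundP.
rewrite (@free_extE _ _ N) => [|i Ni]; last first.
  by rewrite coefP Nx // Ny // mulr0 addr0.
rewrite (free_extE _ Nx) (free_extE _ Ny) scaler_sumr -big_split /=.
by apply: eq_bigr => i _; rewrite coefP scalerDl scalerA.
Qed.
HB.instance Definition _ u :=
  GRing.isLinear.Build S Lfree F *:%R (free_ext u) (free_ext_linear u).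

Lemma free_ext_base u k : free_ext u (ebase k) = u k.
Proof.
rewrite (@free_extE _ _ k.+1) => [|i ki].
  rewrite big_nat_recr //= ebaseE eqxx scale1r big_nat big1 ?add0r // => i.
  by case/andP=> _ ik; rewrite ebaseE ltn_eqF // scale0r.
by rewrite ebaseE gtn_eqF.
Qed.

End FreeModule.

Arguments ebase {S}.

Lemma Lfree_sum (S : pzRingType) (x : Lfree S) : x = free_ext ebase x.
Proof.
apply: LfreeP => j.
have sE (I : seq nat) (f : nat -> S) :
    coef (\sum_(i <- I) f i *: (ebase i : Lfree S)) j
      = \sum_(i <- I) f i * (j == i)%:R :> S.
  elim: I => [|i I IH]; first by rewrite !big_nil.
  by rewrite !big_cons -IH -[f i * _]/(f i *: (_ : S^o)) -(ebaseE S i j).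
rewrite (@free_extE _ _ _ x (maxn (supp_bound x) j.+1)); last first.
  by move=> i; rewrite geq_max => /andP[h _]; apply: supp_boundP.
rewrite sE (@big_nat_only _ _ _ j) ?leq_max ?ltnSn ?orbT ?eqxx ?mulr1 // => i.
by rewrite eq_sym => /negbTE->; rewrite mulr0.
Qed.

Lemma linear_free_ext (S : pzRingType) (F : lmodType S)
    (f : {linear Lfree S -> F}) :
  f =1 free_ext (fun i => f (ebase i)).
Proof.
move=> x; rewrite {1}(Lfree_sum x) /free_ext linear_sum.
by apply: eq_bigr => i _; rewrite linearZ.
Qed.

Lemma linear_free_eq (S : pzRingType) (F : lmodType S)
    (f g : {linear Lfree S -> F}) :
  (forall i, f (ebase i) = g (ebase i)) -> f =1 g.
Proof.
move=> fg x; rewrite (linear_free_ext f) (linear_free_ext g) /free_ext.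
by apply: eq_bigr => i _; rewrite fg.
Qed.

(** * The equational criterion for flatness *)

(** The equational criterion for flatness, for one relation: a relation
phi a = 0 between elements of F is explained by a relation beta a = 0 between
elements of a free module. *)
Definition eqflat (S : pzRingType) (F : lmodType S) : Prop :=
  forall (phi : {linear Lfree S -> F}) a, phi a = 0 ->
  exists (beta : {linear Lfree S -> Lfree S}) (psi : {linear Lfree S -> F}),
    (forall x, phi x = psi (beta x)) /\ beta a = 0.

Lemma zmod_morphism_of_add (U V : zmodType) (f : U -> V) :
  {morph f : x y / x + y} -> zmod_morphism f.
Proof. by move=> fD x y; apply: (@addIr _ (f y)); rewrite -fD !subrK. Qed.

Section TensorMapAdditive.
Variables (R : pzRingType) (F G : lmodType R^c) (A B : lmodType R).
Variables (f : {linear F -> G}) (g : {linear A -> B}).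
HB.instance Definition _ := GRing.isZmodMorphism.Build
  (tensor F A) (tensor G B) (tensor_map f g)
  (zmod_morphism_of_add (tensor_mapD f g)).
End TensorMapAdditive.

Section TensSum.
Variables (R : pzRingType) (F : lmodType R^c) (A : lmodType R).

Lemma tens0l (a : A) : tens (0 : F) a = 0.
Proof. by apply: (@addIr _ (tens (0 : F) a)); rewrite -tensDl !add0r. Qed.

Lemma tens_suml I (r : seq I) (y : I -> F) (a : A) :
  tens (\sum_(i <- r) y i) a = \sum_(i <- r) tens (y i) a.
Proof.
exact: (big_morph (fun x => tens x a) (fun x y => tensDl x y a) (tens0l a)).
Qed.

End TensSum.

Section FlatEqflat.
Variables (R : pzRingType) (F : lmodType R^c).
Variables (k : nat) (a : nat -> R).

(** The map of left modules that sends r to the sum of the r_i a_i, i < k. *)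
Definition relsum (r : Lprod R) : (R^o : lmodType R) :=
  \sum_(0 <= i < k) (r i : R) * a i.

Lemma relsum_linear : linear relsum.
Proof.
move=> c r s; rewrite /relsum scaler_sumr -big_split /=.
apply: eq_bigr => i _.
by rewrite -[LHS]/((c * (r i : R) + (s i : R)) * a i) mulrDl -mulrA.
Qed.
HB.instance Definition _ :=
  GRing.isLinear.Build R (Lprod R) (R^o) *:%R relsum relsum_linear.

Lemma relgroup0 : relsum 0 = 0. Proof. exact: raddf0. Qed.
Lemma relgroupB r s : relsum r = 0 -> relsum s = 0 -> relsum (r - s) = 0.
Proof. by rewrite raddfB /= => -> ->; rewrite subr0. Qed.
Lemma relgroupZ c r : relsum r = 0 -> relsum (c *: r) = 0.
Proof. by rewrite linearZ /= => ->; rewrite scaler0. Qed.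

(** The relations among a_0, ..., a_(k-1): the kernel of [relsum]. *)
Definition relmod : submodule (Lprod R) :=
  @Submodule R (Lprod R) (Subgroup relgroup0 relgroupB) relgroupZ.

(** The sequences of elements of F. *)
Definition Fseq : lmodType R^c := dprod (fun _ : nat => F).

Definition lcomb (s : seq (F * Lprod R)) : Fseq :=
  fun i => \sum_(p <- s) ((p.2 i : R) : R^c) *: p.1.

(** The sequences that are sums of products y r with y in F and r a relation.
They form a subgroup of [Fseq]. *)
Definition relspan (f : Fseq) : Prop :=
  exists2 s, (forall p, p \in s -> relmod p.2) & f = lcomb s.

Lemma relspan0 : relspan 0.
Proof.
exists [::] => //; apply: functional_extensionality_dep => i.
by rewrite /lcomb big_nil.
Qed.

Lemma relspanB f g : relspan f -> relspan g -> relspan (f - g).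
Proof.
move=> [s sK ->] [t tK ->].
exists (s ++ [seq (- p.1, p.2) | p <- t]).
  move=> p; rewrite mem_cat => /orP[/sK //|/mapP[q /tK qK ->]].
  exact: qK.
apply: functional_extensionality_dep => i.
rewrite -[LHS]/(lcomb s i - lcomb t i) /lcomb big_cat big_map /= -sumrN.
by congr +%R; apply: eq_bigr => p _; rewrite scalerN.
Qed.

Definition relspan_group := Subgroup relspan0 relspanB.

Definition seqmul (y : F) (r : Lprod R) : Fseq :=
  fun i => ((r i : R) : R^c) *: y.

Lemma relspan1 y r : relmod r -> relspan_group (seqmul y r).
Proof.
move=> rK; exists [:: (y, r)]; first by move=> p; rewrite inE => /eqP->.
by apply: functional_extensionality_dep => i; rewrite /lcomb big_seq1.
Qed.

Lemma seqmulDl x y r : seqmul (x + y) r = seqmul x r + seqmul y r.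
Proof. by apply: functional_extensionality_dep => i; apply: scalerDr. Qed.
Lemma seqmulDr x r s : seqmul x (r + s) = seqmul x r + seqmul x s.
Proof. by apply: functional_extensionality_dep => i; apply: scalerDl. Qed.
Lemma seqmulBr x r s : seqmul x (r - s) = seqmul x r - seqmul x s.
Proof. by apply: functional_extensionality_dep => i; apply: scalerBl. Qed.
Lemma seqmul_bal (c : R) x r : seqmul ((c : R^c) *: x) r = seqmul x (c *: r).
Proof.
apply: functional_extensionality_dep => i.
by rewrite -[RHS]/((@GRing.mul R^c (r i) c) *: x) -scalerA.
Qed.

(** The balanced map that sends y and the class of r to the class of the
sequence y r_i.  It shows that an element
y_0 (x) [e_0] + ... + y_(k-1) (x) [e_(k-1)] of the tensor product of F with the
quotient by [relmod] vanishes only if the sequence y_0, ..., y_(k-1), 0, 0, ...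
belongs to [relspan]. *)
Definition relbil (y : F) (u : quot_mod relmod) : quot_group relspan_group :=
  group_pi relspan_group (seqmul y (repr u)).

Lemma relbil_pi y r : relbil y (quot_pi relmod r) = group_pi _ (seqmul y r).
Proof.
apply/group_pi_eqE; rewrite -seqmulBr; apply: relspan1.
exact: quot_repr_pi.
Qed.

Lemma relbil_balanced : balanced relbil.
Proof.
split=> [x y u|x u v|c x u].
- by rewrite /relbil seqmulDl raddfD.
- by rewrite -(quot_piK u) -(quot_piK v) -raddfD !relbil_pi seqmulDr raddfD.
- by rewrite -(quot_piK u) -linearZ !relbil_pi seqmul_bal.
Qed.

(** A relation with coefficients a among elements y of F is a consequence of
relations among the a_i.  The left module of sequences modulo [relmod] embeds
in R, with e_i sent to a_i; the relation says that the element
y_0 (x) [e_0] + ... + y_(k-1) (x) [e_(k-1)] vanishes in the tensor product of F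
with R, hence it vanishes before the embedding. *)
Lemma flat_relation (y : nat -> F) : flat F ->
  \sum_(0 <= i < k) ((a i : R) : R^c) *: y i = 0 ->
  exists s : seq (F * Lprod R), (forall p, p \in s -> relsum p.2 = 0) /\
    forall i, (i < k)%N -> y i = \sum_(p <- s) ((p.2 i : R) : R^c) *: p.1.
Proof.
move=> fF ya.
have relmod0 r : relmod r -> relsum r = 0 by [].
pose g : {linear quot_mod relmod -> (R^o : lmodType R)} :=
  quot_lift relmod0.
have gE r : g (quot_pi relmod r) = relsum r by apply: quot_lift_pi.
have g_inj : injective g.
  move=> u v; rewrite -(quot_piK u) -(quot_piK v) !gE => uv.
  by apply/quot_pi_eqE; rewrite /= raddfB /= uv subrr.
have gdelta i : (i < k)%N -> g (quot_pi relmod (delta R i)) = a i *: (1 : R^o).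
  move=> ik; rewrite gE -[RHS]/(a i * 1) mulr1 /relsum.
  rewrite (big_nat_only ik) /delta ?eqxx ?mul1r // => j /negbTE->.
  by rewrite mul0r.
pose u : tensor F (quot_mod relmod) :=
  \sum_(0 <= i < k) tens (y i) (quot_pi relmod (delta R i)).
have u0 : u = 0.
  apply: (fF _ _ g g_inj); rewrite raddf0 raddf_sum /=.
  under eq_big_nat => i ik.
    rewrite tensor_map_tens gdelta; last by case/andP: ik.
    rewrite -tens_bal.
    over.
  by rewrite -tens_suml ya tens0l.
have := congr1 (tensor_lift relbil) u0.
have bal := relbil_balanced.
rewrite (tensor_lift_class bal [::]) big_nil /u.
rewrite (big_morph _ (tensor_liftD bal) (tensor_lift_class bal [::])) big_nil.
under eq_big_nat => i ik do rewrite (tensor_lift_tens bal) relbil_pi.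
rewrite -raddf_sum => /group_pi_eq0[s sK es].
exists s; split=> // i ik.
rewrite -[RHS]/(lcomb s i) -es.
have sumE (I : seq nat) :
    (\sum_(j <- I) seqmul (y j) (delta R j)) i =
      \sum_(j <- I) ((i == j)%:R : R^c) *: y j.
  elim: I => [|j I IH]; first by rewrite !big_nil.
  by rewrite !big_cons -IH.
rewrite sumE (big_nat_only ik) ?eqxx ?scale1r // => j.
by rewrite eq_sym => /negbTE->; apply: scale0r.
Qed.
End FlatEqflat.

Lemma flat_eqflat (R : pzRingType) (F : lmodType R^c) : flat F -> eqflat F.
Proof.
move=> fF phi a pa.
have pa' : \sum_(0 <= i < supp_bound a)
    ((coef a i : R) : R^c) *: phi (ebase i) = 0.
  exact: etrans (esym (linear_free_ext phi a)) pa.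
have [s [sK sE]] := flat_relation fF pa'.
pose l := size s.
pose x0 : F * Lprod R := (0, 0).
(* The first l basis vectors carry the factorization of the values of phi on
the support of a; the basis vectors off this support are shifted by l. *)
pose b i : Lfree R^c := if (i < supp_bound a)%N then
    \sum_(0 <= j < l) (((nth x0 s j).2 i : R) : R^c) *: ebase j
  else ebase (l + i)%N.
pose y j : F := if (j < l)%N then (nth x0 s j).1 else phi (ebase (j - l)%N).
exists (free_ext b), (free_ext y); split.
  move=> x; apply: (@linear_free_eq _ _ phi (free_ext y \o free_ext b)) => i /=.
  rewrite free_ext_base /b; case: ifP => [ik|_].
    rewrite sE // (big_nth x0) linear_sum; apply: eq_big_nat => j /andP[_ jl].
    by rewrite linearZ /= free_ext_base /y jl.
  by rewrite free_ext_base /y ltnNge leq_addr /= addKn.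
rewrite -[LHS]/(\sum_(0 <= i < supp_bound a) coef a i *: b i).
under eq_big_nat => i /andP[_ ik] do rewrite /b ik scaler_sumr.
rewrite exchange_big /= big_nat big1 // => j /andP[_ jl].
under eq_bigr => i _ do rewrite scalerA.
rewrite -scaler_suml.
have /sK rel : nth x0 s j \in s by rewrite mem_nth.
rewrite [X in X *: _](_ : _ =
  relsum (supp_bound a) (coef a : nat -> R) (nth x0 s j).2) //.
by rewrite rel scale0r.
Qed.

(** * Pure submodules *)

(** Purity of G in F, for one equation: if the sum of the x_i a_i belongs to G
for some x_i in F, it is also the sum of the x'_i a_i for some x'_i in G. *)
Definition eqpure (S : pzRingType) (F : lmodType S) (G : F -> Prop) : Prop :=
  forall (phi : {linear Lfree S -> F}) a, G (phi a) ->
  exists phi' : {linear Lfree S -> F},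
    (forall x, G (phi' x)) /\ phi' a = phi a.

Section Purity.
Variables (S : pzRingType) (F : lmodType S) (G : submodule F).

Lemma lift_quot (phi : {linear Lfree S -> quot_mod G}) :
  exists psi : {linear Lfree S -> F}, forall x, quot_pi G (psi x) = phi x.
Proof.
exists (free_ext (fun i => repr (phi (ebase i)))).
apply: (@linear_free_eq _ _ (quot_pi G \o free_ext _) phi) => i /=.
by rewrite free_ext_base quot_piK.
Qed.

Lemma eqflat_quot : eqflat F -> eqpure G -> eqflat (quot_mod G).
Proof.
move=> fF pG phi a pa; have [psi psiE] := lift_quot phi.
have /pG[chi [chiG chia]] : G (psi a) by apply/quot_pi_eq0; rewrite psiE.
have [|b [om [omE ba]]] := fF (psi \- chi) a; first by rewrite /= chia subrr.
exists b, (quot_pi G \o om); split=> // x /=.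
rewrite -omE -psiE; apply/quot_pi_eqE => /=.
by rewrite opprB addrC subrK.
Qed.

Lemma eqpure_quot (T : quot_mod G -> Prop) :
  eqpure G -> eqpure T -> eqpure (fun x => T (quot_pi G x)).
Proof.
move=> pG pT phi a Ta.
have [psi [psiT psia]] := pT (quot_pi G \o phi) a Ta.
have [om omE] := lift_quot psi.
have /pG[chi [chiG chia]] : G ((phi \- om) a).
  by apply/quot_pi_eqE; rewrite omE psia.
exists (om \+ chi); split=> [x|] /=; last by rewrite chia /= addrC subrK.
rewrite raddfD /= omE; have /quot_pi_eq0-> := chiG x.
by rewrite addr0.
Qed.

End Purity.

(** * Sequences of free modules with flat limit *)

Section BassSequence.
Variables (S : pzRingType) (F : lmodType S).
Hypothesis fF : eqflat F.
Local Notation L := (Lfree S).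
Implicit Type v : {linear L -> F}.

(** If F is flat and the element v c of F has the form f a, then v factors
through a free module in which the image of c already has this form.  For
a = 0 this says that an element of the kernel of v can be killed. *)
Lemma eqflat_factor v (c a : L) :
  exists (b : {linear L -> L}) (psi : {linear L -> F}),
    (forall x, v x = psi (b x)) /\
    ((exists f : {linear L -> F}, f a = v c) ->
     exists f : {linear L -> L}, b c = f a).
Proof.
have [[f fa]|nf] := pselect (exists f : {linear L -> F}, f a = v c); last first.
  by exists idfun, v; split=> // /nf.
(* The relation f a - v c = 0, where the basis vectors below k are sent to the
values of f and the following ones to those of v. *)
pose k := supp_bound a.
pose sh : {linear L -> L} := free_ext (fun i => ebase (k + i)%N).
pose phi : {linear L -> F} :=
  free_ext (fun i => if (i < k)%N then f (ebase i) else v (ebase (i - k)%N)).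
have phish : forall x, v x = phi (sh x).
  apply: (@linear_free_eq _ _ v (phi \o sh)) => i.
  by rewrite /= /sh /phi !free_ext_base ltnNge leq_addr addKn.
have phia : phi a = f a.
  rewrite (linear_free_ext f) /phi /= /free_ext.
  apply: eq_big_nat => i /andP[_ ik].
  by rewrite ik.
have [|b [psi [psiE ba]]] := fF (phi := phi) (a := a - sh c).
  by rewrite raddfB /= -phish phia fa subrr.
exists (b \o sh), psi; split=> [x|_]; first by rewrite phish psiE.
exists b; apply/esym/subr0_eq; rewrite -ba raddfB //.
Qed.

(** Maps v n : L -> F compatible with endomorphisms b n of L, where H m n is
the composition of b n, ..., b (m - 1).  The entry e m = (n, c, a) is a request
treated at step m: if the element of F represented by c at stage n has the form
f a with f : L -> F, it acquires this form in L at stage m + 1. *)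
Lemma bass_sequence (e : nat -> nat * L * L) (v0 : {linear L -> F}) :
  exists (v : nat -> {linear L -> F}) (b : nat -> {linear L -> L})
    (H : nat -> nat -> {linear L -> L}),
  [/\ v 0%N = v0, forall n x, v n x = v n.+1 (b n x),
      forall n x, H n n x = x,
      forall m n x, (n <= m)%N -> H m.+1 n x = b m (H m n x) &
      forall m n c a, e m = (n, c, a) ->
        (exists f : {linear L -> F}, f a = v m (H m n c)) ->
        exists f : {linear L -> L}, b m (H m n c) = f a].
Proof.
(* A state is the current map to F, with the transitions to the current stage
from each earlier stage; the transitions from later stages are dummies. *)
pose T : Type := ({linear L -> F} * (nat -> {linear L -> L}))%type.
pose P (m : nat) (t : T) (p : {linear L -> L} * {linear L -> F}) :=
  (forall x, t.1 x = p.2 (p.1 x)) /\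
  ((exists f : {linear L -> F}, f (e m).2 = t.1 (t.2 (e m).1.1 (e m).1.2)) ->
     exists f : {linear L -> L}, p.1 (t.2 (e m).1.1 (e m).1.2) = f (e m).2).
have exP m t : exists p, P m t p.
  have [b [psi bpsi]] := eqflat_factor t.1 (t.2 (e m).1.1 (e m).1.2) (e m).2.
  by exists (b, psi).
pose nx m t := projT1 (cid (exP m t)).
have nxP m t : P m t (nx m t) := projT2 (cid (exP m t)).
pose st := fix st m : T := if m is m'.+1 then
    let t := st m' in let p := nx m' t in
    (p.2, fun n => if (n <= m')%N then p.1 \o t.2 n : {linear L -> L}
                   else (idfun : {linear L -> L}))
  else (v0, fun=> (idfun : {linear L -> L})).
exists (fun m => (st m).1), (fun m => (nx m (st m)).1), (fun m => (st m).2).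
split=> //.
- by move=> n x; have [h _] := nxP n (st n); apply: h.
- by case=> [|n] x //=; rewrite ltnn.
- by move=> m n x nm /=; rewrite nm.
- by move=> m n c a em; have [_] := nxP m (st m); rewrite em.
Qed.

End BassSequence.

(** * Enumerations *)

Lemma enum_repeat (T : Type) (f : T -> nat) (t0 : T) : injective f ->
  exists e : nat -> T, forall t n, exists2 m, (n <= m)%N & e m = t.
Proof.
move=> f_inj.
(* Each value of the 2-adic valuation is taken by arbitrarily large numbers. *)
pose e m := if pselect (exists t, f t = logn 2 m) is left h
  then projT1 (cid h) else t0.
exists e => t n; exists (2 ^ f t * n.*2.+1)%N.
  rewrite -[leqLHS]mul1n leq_mul // ?expn_gt0 // -addnn.
  by rewrite -addnS leq_addr.
have -> : e (2 ^ f t * n.*2.+1)%N = e (2 ^ f t)%N.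
  rewrite /e lognM ?expn_gt0 // pfactorK // (@logn_coprime 2 n.*2.+1) ?addn0 //.
  by rewrite coprime2n /= odd_double.
rewrite /e pfactorK //; case: pselect => [h|[]]; last by exists t.
by case: (cid h) => t' /= /f_inj.
Qed.

Lemma Lfree_countable (S : pzRingType) : countable [set: S] ->
  exists f : Lfree S -> nat, injective f.
Proof.
move=> /countable_injP[f f_inj].
exists (fun x => pickle [seq f (coef x i) | i <- iota 0 (supp_bound x)]).
move=> x y /(pcan_inj pickleK) xy.
have bxy : supp_bound x = supp_bound y.
  by have := congr1 size xy; rewrite !size_map !size_iota.
apply: LfreeP => i; have [ix|xi] := ltnP i (supp_bound x); last first.
  by rewrite !supp_boundP -?bxy.
have := congr1 (fun s => nth 0%N s i) xy => /=.
rewrite !(nth_map 0%N) ?size_iota -?bxy // nth_iota // add0n.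
by apply: f_inj; rewrite in_setT.
Qed.

(** * Solving telescoping equations with infinite sequences *)

(** Any map from the direct sum of countably many copies of S to M extends to
the direct product. *)
Definition extends_prod (S : pzRingType) (M : lmodType S) : Prop :=
  forall m : nat -> M,
  exists h : {linear Lprod S -> M}, forall k, h (delta S k) = m k.

Section Telescope.
Variables (S : pzRingType) (M : lmodType S).
Hypothesis extM : extends_prod M.
Local Notation L := (Lfree S).
Variables (b : nat -> {linear L -> L}) (H : nat -> nat -> {linear L -> L}).
Hypothesis H0 : forall n x, H n n x = x.
Hypothesis HS : forall m n x, (n <= m)%N -> H m.+1 n x = b m (H m n x).

Lemma transition_shift m n x : (n < m)%N -> H m n x = H m n.+1 (b n x).
Proof.
elim: m => // m IH; rewrite ltnS leq_eqVlt => /orP[/eqP->|nm].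
  by rewrite HS // !H0.
by rewrite HS ?(ltnW nm) // HS // IH.
Qed.

(** The sum over m >= n of the copies in row m of the images of x at stage m,
as an element of the product indexed by pairs (m, i), coded by their index k. *)
Definition tele (n : nat) (x : L) : Lprod S := fun k =>
  if pickle_inv k is Some (m, i)
  then if (n <= m)%N then coef (H m n x) i else 0 else 0.

Lemma tele_linear n : linear (tele n).
Proof.
move=> r x y; apply: functional_extensionality_dep => k.
rewrite -[RHS]/((r * (tele n x k : S) + (tele n y k : S)) : S) /tele.
case: pickle_inv => [[m i]|]; last by rewrite mulr0 addr0.
by case: ifP => _; [rewrite linearP coefP|rewrite mulr0 addr0].
Qed.
HB.instance Definition _ n :=
  GRing.isLinear.Build S L (Lprod S) *:%R (tele n) (tele_linear n).

Lemma tele_diff n x : tele n x - tele n.+1 (b n x) =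
  \sum_(0 <= i < supp_bound x) coef x i *: (delta S (pickle (n, i)) : Lprod S).
Proof.
apply: functional_extensionality_dep => k.
rewrite -[LHS]/((tele n x k : S) - (tele n.+1 (b n x) k : S)).
have sumE (I : seq nat) :
    (\sum_(i <- I) coef x i *: (delta S (pickle (n, i)) : Lprod S)) k
     = \sum_(i <- I) coef x i * (k == pickle (n, i))%:R :> S.
  elim: I => [|i I IH]; first by rewrite !big_nil.
  by rewrite !big_cons -IH.
rewrite sumE /tele; case E: (pickle_inv k) => [[m i]|]; last first.
  rewrite subr0 big1 // => i _; case: eqP => [ki|_]; last by rewrite mulr0.
  by move: E; rewrite ki pickleK_inv.
have kE : k = pickle (m, i).
  by have := @pickle_invK (nat * nat)%type k; rewrite E.
have eqE j : (k == pickle (n, j)) = ((m, i) == (n, j)).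
  by rewrite kE (inj_eq (pcan_inj pickleK_inv)).
under eq_bigr => j _ do rewrite eqE xpair_eqE.
have [nm|mn|<-] := ltngtP n m.
- rewrite transition_shift // subrr big1 // => j _.
  by rewrite mulr0.
- by rewrite subr0 big1 // => j _; rewrite mulr0.
rewrite subr0 H0 /=.
have [ix|xi] := ltnP i (supp_bound x); last first.
  rewrite supp_boundP // big_nat big1 // => j /andP[_ jx].
  by rewrite gtn_eqF ?mulr0 // (leq_trans jx xi).
rewrite (big_nat_only ix) ?eqxx ?mulr1 // => j.
by rewrite eq_sym => /negbTE->; rewrite mulr0.
Qed.

(** The equations z_n - z_(n+1) b_n = d_n are solvable in maps from L to M:
they are in the product, where the terms d_n are replaced by the canonical basis
and the solution is [tele]. *)
Lemma telescope (d : nat -> nat -> M) :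
  exists z : nat -> {linear L -> M},
    forall n x, z n x = z n.+1 (b n x) + free_ext (d n) x.
Proof.
have [h hE] := extM (fun k => if pickle_inv k is Some (n, i) then d n i else 0).
exists (fun n => h \o tele n) => n x /=.
apply/eqP; rewrite addrC -subr_eq -raddfB /= tele_diff linear_sum; apply/eqP.
by apply: eq_bigr => i _; rewrite linearZ /= hE pickleK_inv.
Qed.

End Telescope.

(** * Splitting extensions of flat modules *)

Section PureSection.
Variables (S : pzRingType) (M E F : lmodType S).
Variables (inj : {linear M -> E}) (pr : {linear E -> F}).
Hypothesis countS : countable [set: S].
Hypothesis extM : extends_prod M.
Hypothesis pr_surj : forall y, exists x, pr x = y.
Hypothesis exact_E : forall x, pr x = 0 <-> exists z, inj z = x.
Hypothesis fF : eqflat F.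
Local Notation L := (Lfree S).

(** The submodules T of E such that pr is an isomorphism from T to a pure
submodule of F. *)
Definition pure_section (T : submodule E) : Prop :=
  (forall x, T x -> pr x = 0 -> x = 0) /\
  eqpure (fun y => exists2 x, T x & pr x = y).

(** T is the union of the images of corrected lifts w' n : L -> E of maps
v n : L -> F as in [bass_sequence].  Killing the kernels of the v n ensures that
pr is injective on T, and the other requests make the image pure. *)
Lemma pure_section_at (y0 : F) :
  exists2 T : submodule E, pure_section T & exists2 x, T x & pr x = y0.
Proof.
have [f f_inj] := Lfree_countable countS.
have cd_inj : injective (fun t : nat * L * L => pickle (t.1.1, f t.1.2, f t.2)).
  by move=> [[n c] a] [[n' c'] a'] /(pcan_inj pickleK)[-> /f_inj-> /f_inj->].
have [e eP] := enum_repeat (0%N, 0 : L, 0 : L) cd_inj.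
have [v [b [H [v0 vb H0 HS He]]]] := bass_sequence fF e (free_ext (fun=> y0)).
have [s sP] := choice pr_surj.
pose w n : {linear L -> E} := free_ext (fun i => s (v n (ebase i))).
have prw n x : pr (w n x) = v n x.
  apply: (@linear_free_eq _ _ (pr \o w n) (v n)) => i /=.
  by rewrite free_ext_base sP.
have /choice[d dP] : forall n, exists d : nat -> M, forall i,
    inj (d i) = w n (ebase i) - w n.+1 (b n (ebase i)).
  move=> n; suff /choice[d dP] : forall i, exists z,
      inj z = w n (ebase i) - w n.+1 (b n (ebase i)) by exists d.
  by move=> i; apply/exact_E; rewrite raddfB /= !prw -vb subrr.
have [z zE] := telescope extM H0 HS d.
pose w' n : {linear L -> E} := w n \- (inj \o z n).
have prw' n x : pr (w' n x) = v n x.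
  rewrite raddfB /= prw; have -> : pr (inj (z n x)) = 0; last by rewrite subr0.
  by apply/exact_E; exists (z n x).
have w'b n x : w' n x = w' n.+1 (b n x).
  apply: (@linear_free_eq _ _ (w' n) (w' n.+1 \o b n)) => i.
  rewrite -[LHS]/(w n (ebase i) - inj (z n (ebase i))).
  rewrite zE (free_ext_base (d n)) raddfD /= dP opprD opprB addrCA.
  by rewrite [w n _ + _]addrC subrK addrC.
have w'H m n x : (n <= m)%N -> w' n x = w' m (H m n x).
  elim: m => [|m IH]; first by rewrite leqn0 => /eqP->; rewrite H0.
  rewrite leq_eqVlt => /orP[/eqP->|]; first by rewrite H0.
  by rewrite ltnS => nm; rewrite HS // -w'b IH.
have vH m n x : (n <= m)%N -> v n x = v m (H m n x).
  by move=> nm; rewrite -!prw' (w'H m).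
pose T x := exists n y, w' n y = x.
have T0 : T 0 by exists 0%N, 0; rewrite raddf0.
have TB x y : T x -> T y -> T (x - y).
  move=> [n [x' <-]] [m [y' <-]]; pose k := maxn n m.
  exists k, (H k n x' - H k m y').
  by rewrite (w'H k n x') ?leq_maxl // (w'H k m y') ?leq_maxr // raddfB.
have TZ r x : T x -> T (r *: x).
  by move=> [n [x' <-]]; exists n, (r *: x'); rewrite linearZ.
exists (@Submodule S E (Subgroup T0 TB) TZ); last first.
  exists (w' 0%N (ebase 0%N)); first by exists 0%N, (ebase 0%N).
  by rewrite prw' v0 /= free_ext_base.
split=> /=.
  move=> _ [n [y <-]]; rewrite prw' => vy0.
  have [m nm em] := eP (n, y, 0) n.
  have [|g gE] := He _ _ _ _ em; first by exists \0; rewrite -vH.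
  by rewrite (w'H m) // w'b gE !raddf0.
move=> phi a [_ [n [c <-]]]; rewrite prw' => vc.
have [m nm em] := eP (n, c, a) n.
have [|g gE] := He _ _ _ _ em; first by exists phi; rewrite -vH.
exists (v m.+1 \o g); split=> [x|] /=.
  by exists (w' m.+1 (g x)); [exists m.+1, (g x)|rewrite prw'].
by rewrite -gE -vb -vH.
Qed.

End PureSection.

Section PureSectionExtend.
Variables (S : pzRingType) (M E F : lmodType S).
Variables (inj : {linear M -> E}) (pr : {linear E -> F}).
Hypothesis countS : countable [set: S].
Hypothesis extM : extends_prod M.
Hypothesis pr_surj : forall y, exists x, pr x = y.
Hypothesis exact_E : forall x, pr x = 0 <-> exists z, inj z = x.
Hypothesis fF : eqflat F.

(** [pure_section_at] for the quotient of the extension by T. *)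
Lemma pure_section_extend (T : submodule E) (y0 : F) : pure_section pr T ->
  exists T' : submodule E, [/\ forall x, T x -> T' x, pure_section pr T' &
    exists2 x, T' x & pr x = y0].
Proof.
move=> [Tker pT].
pose Gset (y : F) := exists2 x, T x & pr x = y.
have G0 : Gset 0 by exists 0; [exact: subgroup0|rewrite raddf0].
have GB x y : Gset x -> Gset y -> Gset (x - y).
  move=> [x' Tx <-] [y' Ty <-]; exists (x' - y'); first exact: subgroupB.
  by rewrite raddfB.
have GZ r x : Gset x -> Gset (r *: x).
  move=> [x' Tx <-]; exists (r *: x'); first exact: submodZ.
  by rewrite linearZ.
pose G : submodule F := @Submodule S F (Subgroup G0 GB) GZ.
have pG : eqpure G := pT.
have pr0 x : T x -> (quot_pi G \o pr) x = 0.
  by move=> Tx /=; apply/quot_pi_eq0; exists x.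
pose pr' : {linear quot_mod T -> quot_mod G} := quot_lift pr0.
have pr'E x : pr' (quot_pi T x) = quot_pi G (pr x) := quot_lift_pi pr0 x.
have pr'_surj u : exists t, pr' t = u.
  have [x xu] := pr_surj (repr u); exists (quot_pi T x).
  by rewrite pr'E xu quot_piK.
have exact' t : pr' t = 0 <-> exists z, (quot_pi T \o inj) z = t.
  split=> [|[z <-]]; last first.
    rewrite [pr' _](pr'E (inj z)).
    have -> : pr (inj z) = 0; last by rewrite raddf0.
    by apply/exact_E; exists z.
  rewrite -(quot_piK t) pr'E => /quot_pi_eq0[x Tx prx].
  have /exact_E[z zE] : pr (repr t - x) = 0 by rewrite raddfB /= prx subrr.
  exists z; apply/quot_pi_eqE => /=.
  by rewrite zE addrAC subrr sub0r; apply: subgroupN.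
have [T1 [T1ker pT1] [t0 T1t0 t0E]] :=
  pure_section_at countS extM pr'_surj exact' (eqflat_quot fF pG)
    (quot_pi G y0).
have hit x y : T1 (quot_pi T x) -> pr' (quot_pi T x) = quot_pi G y ->
    exists2 x', T1 (quot_pi T x') & pr x' = y.
  rewrite pr'E => T1x /quot_pi_eqE[x1 Tx1 x1E]; exists (x - x1).
    rewrite raddfB /=; have /quot_pi_eq0-> := Tx1.
    by rewrite subr0.
  by rewrite raddfB /= x1E subKr.
pose T' x := T1 (quot_pi T x).
have T'0 : T' 0 by rewrite /T' raddf0; apply: subgroup0.
have T'B x y : T' x -> T' y -> T' (x - y).
  by rewrite /T' raddfB; apply: subgroupB.
have T'Z r x : T' x -> T' (r *: x) by rewrite /T' linearZ; apply: submodZ.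
exists (@Submodule S E (Subgroup T'0 T'B) T'Z); split=> /=.
- by move=> x /quot_pi_eq0; rewrite /T' => ->; apply: subgroup0.
- split=> [x T'x prx|] /=.
    apply: Tker => //; apply/quot_pi_eq0/T1ker => //.
    by rewrite pr'E prx raddf0.
  move=> phi a [x T'x xa].
  have [|chi [chiT1 chia]] := eqpure_quot pG pT1 (phi := phi) (a := a).
    by exists (quot_pi T x) => //; rewrite pr'E xa.
  exists chi; split=> // y; have [t T1t] := chiT1 y.
  by rewrite -(quot_piK t); apply: hit; rewrite quot_piK.
- by apply: (hit (repr t0)); rewrite quot_piK.
Qed.

Lemma section_total : exists2 T : submodule E,
  forall x, T x -> pr x = 0 -> x = 0 & forall y, exists2 x, T x & pr x = y.
Proof.
(* The empty set satisfies P, as the union of the empty chain has to. *)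
pose P (A : set E) := [/\ forall r x y, A x -> A y -> A (r *: x + y),
  forall x, A x -> pr x = 0 -> x = 0 &
  eqpure (fun y => exists2 x, A x & pr x = y)].
have [C CP totC|A [[AP Aker pA] Amax]] := @Zorn_bigcup _ P.
  split.
  - move=> r x y [X CX Xx] [Y CY Yy].
    have [XY|YX] := totC _ _ CX CY.
      by have [h _ _] := CP _ CY; exists Y => //; apply: h => //; apply: XY.
    by have [h _ _] := CP _ CX; exists X => //; apply: h => //; apply: YX.
  - by move=> x [X CX Xx]; have [_ h _] := CP _ CX; apply: h.
  - move=> phi a [x [X CX Xx] xa]; have [_ _ h] := CP _ CX.
    have [|phi' [phi'X phi'a]] := h phi a; first by exists x.
    exists phi'; split=> // y; have [x' Xx' x'y] := phi'X y.
    by exists x' => //; exists X.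
have A0 : A 0.
  apply: contrapT => nA0; apply: (Amax [set 0]).
    split=> [x Ax|/(_ 0 erefl) //]; case: nA0.
    by rewrite -(addNr x) -scaleN1r; apply: AP.
  split=> [r x y -> ->|x -> //|phi a [x -> xa]].
    by rewrite /= scaler0 addr0.
  by exists \0; split=> [x0|]; [exists 0; rewrite ?raddf0|rewrite -xa raddf0].
have AB x y : A x -> A y -> A (x - y).
  by move=> Ax Ay; rewrite addrC -scaleN1r; apply: AP.
have AZ r x : A x -> A (r *: x) by move=> Ax; rewrite -[_ *: _]addr0; apply: AP.
pose T : submodule E := @Submodule S E (Subgroup A0 AB) AZ.
exists T => // y.
have [T' [TT' [T'ker pT'] [x T'x xy]]] :=
  @pure_section_extend T y (conj Aker pA).
exists x => //; apply: contrapT => nTx; apply: (Amax T').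
  by split=> // /(_ x T'x).
split=> // r x1 x2 T'x1 T'x2; apply: subgroupD => //; exact: submodZ.
Qed.

Lemma retraction_of_extends : injective inj ->
  exists rho : {linear E -> M}, forall z, rho (inj z) = z.
Proof.
move=> inj_inj; have [T Tker Tsurj] := section_total.
have /choice[rho rhoP] x : exists z, T (x - inj z).
  have [t Tt tx] := Tsurj (pr x).
  have /exact_E[z zE] : pr (x - t) = 0 by rewrite raddfB /= tx subrr.
  by exists z; rewrite zE subKr.
have rho_uniq x z : T (x - inj z) -> rho x = z.
  move=> Tz; apply: inj_inj; apply/subr0_eq/Tker; last first.
    rewrite -raddfB; apply/exact_E; by eexists.
  have -> : inj (rho x) - inj z = (x - inj z) - (x - inj (rho x)).
    by rewrite opprB [RHS]addrC addrA subrK.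
  exact: subgroupB.
have rho_lin : linear rho.
  move=> r x y; apply: rho_uniq; rewrite linearP opprD addrACA -scalerBr.
  by apply: subgroupD => //; apply: submodZ.
pose rhoL : {linear E -> M} :=
  HB.pack rho (GRing.isLinear.Build S E M *:%R rho rho_lin).
exists rhoL => z; apply: rho_uniq; rewrite subrr; exact: subgroup0.
Qed.

End PureSectionExtend.

Lemma ext_equiv_trivial (R : pzRingType) (F M : lmodType R^c)
    (E : extension F M) (rho : {linear ext_mod E -> M}) :
  (forall z, rho (ext_in E z) = z) ->
  ext_equiv E (trivial_ext F M).
Proof.
move=> rhoK.
pose h x : M * F := (rho x, ext_pr E x).
have h_lin : linear h by move=> r x y; rewrite /h !linearP.
pose hL : {linear ext_mod E -> (M * F)%type} :=
  HB.pack h (GRing.isLinear.Build _ _ _ *:%R h h_lin).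
have pr_in z : ext_pr E (ext_in E z) = 0 by apply/ext_exact; exists z.
exists hL; split=> //; last by move=> z; rewrite /= /h rhoK pr_in.
have [s sP] := choice (@ext_pr_surj _ _ _ E).
exists (fun p => s p.2 + ext_in E (p.1 - rho (s p.2))) => [x|[z y]] /=.
  have /ext_exact[z zE] : ext_pr E (x - s (ext_pr E x)) = 0.
    by rewrite raddfB /= sP subrr.
  have -> : rho x - rho (s (ext_pr E x)) = rho (x - s (ext_pr E x)).
    by rewrite raddfB.
  by rewrite -zE rhoK zE addrC subrK.
congr pair; first by rewrite linearD rhoK addrC subrK.
by rewrite linearD pr_in addr0 sP.
Qed.

(** * Flat quotients *)

Lemma tensor_map_comp (R : pzRingType) (F F1 F2 : lmodType R^c)
  (A A1 A2 : lmodType R) (f : {linear F -> F1}) (f1 : {linear F1 -> F2})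
  (f2 : {linear F -> F2}) (g : {linear A -> A1}) (g1 : {linear A1 -> A2})
  (g2 : {linear A -> A2}) :
  (forall x, f1 (f x) = f2 x) -> (forall a, g1 (g a) = g2 a) ->
  forall u, tensor_map f1 g1 (tensor_map f g u) = tensor_map f2 g2 u.
Proof.
move=> fE gE u; rewrite -(tensor_classK u) !tensor_map_class -map_comp.
by congr tensor_class; apply: eq_map => p /=; rewrite fE gE.
Qed.

Section FlatQuotient.
Variables (R : pzRingType) (F : lmodType R^c) (G : submodule F).
Variable tau : nat -> {linear F -> F}.
Hypothesis tauG : forall n x, G (x - tau n x).
Hypothesis Gtau : forall x, G x -> exists n, tau n x = 0.
Hypothesis tau_le : forall m n x, (m <= n)%N -> tau n (tau m x) = tau n x.

Section TensorQuotient.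
Variable B : lmodType R.
Local Notation tmap n := (tensor_map (tau n) (@idfun B)).

(** The elements of the tensor product killed by some tau n; they form the
kernel of the projection to the tensor product of the quotient F / G with B. *)
Definition tail0_set (u : tensor F B) : Prop := exists n, tmap n u = 0.

Lemma tail0_le m n u : (m <= n)%N -> tmap m u = 0 -> tmap n u = 0.
Proof.
move=> mn um.
rewrite -(@tensor_map_comp R F F F B B B (tau m) (tau n) (tau n)
  idfun idfun idfun) //.
  by rewrite um raddf0.
by move=> x; apply: tau_le.
Qed.

Lemma tail0_0 : tail0_set 0. Proof. by exists 0%N; rewrite raddf0. Qed.

Lemma tail0_B u v : tail0_set u -> tail0_set v -> tail0_set (u - v).
Proof.
move=> [m um] [n vn]; exists (maxn m n).
rewrite raddfB /= (tail0_le (leq_maxl m n) um).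
by rewrite (tail0_le (leq_maxr m n) vn) subrr.
Qed.

Definition tail0 : subgroup (tensor F B) := Subgroup tail0_0 tail0_B.

(** The balanced map inducing a map from the tensor product of F / G with B to
the quotient by [tail0]. *)
Definition quot_tens (q : quot_mod G) (b : B) : quot_group tail0 :=
  group_pi tail0 (tens (repr q) b).

Lemma quot_tens_pi x b : quot_tens (quot_pi G x) b = group_pi tail0 (tens x b).
Proof.
apply/group_pi_eqE.
have [n nE] := Gtau (quot_repr_pi G x); exists n.
rewrite raddfB /= !tensor_map_tens -[tau n (repr _)](subrK (tau n x)).
by rewrite -raddfB /= nE add0r subrr.
Qed.

Lemma quot_tens_balanced : balanced quot_tens.
Proof.
split=> [p q b|q b c|r q b].
- by rewrite -(quot_piK p) -(quot_piK q) -raddfD !quot_tens_pi tensDl raddfD.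
- by rewrite /quot_tens tensDr raddfD.
- by rewrite -(quot_piK q) -linearZ !quot_tens_pi tens_bal.
Qed.

Lemma quot_tens_map (A : lmodType R) (g : {linear A -> B}) (u : tensor F A) :
  tensor_lift quot_tens (tensor_map (quot_pi G) g u) =
  group_pi tail0 (tensor_map idfun g u).
Proof.
have bal := quot_tens_balanced.
rewrite -(tensor_classK u) !tensor_map_class (tensor_lift_class bal).
rewrite tensor_classE raddf_sum !big_map.
by apply: eq_bigr => p _; rewrite quot_tens_pi.
Qed.

End TensorQuotient.

(** F / G is flat if F is flat and the endomorphisms tau n are congruent to the
identity modulo G and eventually kill each element of G. *)
Lemma flat_quot : flat F -> flat (quot_mod G).
Proof.
move=> fF A B g g_inj; apply: raddf_inj => w gw.
pose s : seq (F * A) := [seq (repr p.1, p.2) | p <- repr w].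
pose u : tensor F A := tensor_class s.
have wE : tensor_map (quot_pi G) idfun u = w.
  rewrite tensor_map_class -[RHS]tensor_classK -map_comp; congr tensor_class.
  by rewrite -[RHS]map_id; apply: eq_map => [[q a]] /=; rewrite quot_piK.
have : tensor_map (quot_pi G) g u = 0.
  rewrite -gw -wE /=; apply/esym.
  exact: tensor_map_comp.
move=> /(congr1 (tensor_lift (@quot_tens B))).
rewrite quot_tens_map (tensor_lift_class (@quot_tens_balanced B) [::]) big_nil.
move=> /group_pi_eq0[n].
rewrite (@tensor_map_comp _ _ _ _ _ _ _ _ _ (tau n) _ _ g) // => un.
have {}un : tensor_map (tau n) idfun u = 0.
  apply: (fF _ _ g g_inj); rewrite raddf0.
  by rewrite (@tensor_map_comp _ _ _ _ _ _ _ _ _ (tau n) _ _ g).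
rewrite -wE -(@tensor_map_comp _ _ _ _ _ _ _ (tau n) (quot_pi G) _
  idfun idfun) //.
  by rewrite un raddf0.
by move=> x; apply/esym/quot_pi_eqE.
Qed.

End FlatQuotient.

Section Tail.
Variable S : pzRingType.

(** Dropping the first n coordinates. *)
Definition tail (n : nat) (f : Lprod S) : Lprod S :=
  fun i => if (n <= i)%N then f i else 0.

Lemma tail_linear n : linear (tail n).
Proof.
move=> r f g; apply: functional_extensionality_dep => i.
rewrite -[RHS]/((r * (tail n f i : S) + (tail n g i : S)) : S) /tail.
by case: ifP => // _; rewrite mulr0 addr0.
Qed.
HB.instance Definition _ n :=
  GRing.isLinear.Build S (Lprod S) (Lprod S) *:%R (tail n) (tail_linear n).

Definition Lincl (x : Lfree S) : Lprod S := coef x.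

(** The image of [Lfree] in [Lprod]. *)
Definition finite_support (f : Lprod S) : Prop := exists x, Lincl x = f.

Lemma finite_support0 : finite_support 0.
Proof. by exists 0. Qed.

Lemma finite_supportB f g :
  finite_support f -> finite_support g -> finite_support (f - g).
Proof. by move=> [x <-] [y <-]; exists (x - y). Qed.

Lemma finite_supportZ r f : finite_support f -> finite_support (r *: f).
Proof. by move=> [x <-]; exists (r *: x). Qed.

Definition finsupp_mod : submodule (Lprod S) :=
  @Submodule S (Lprod S) (Subgroup finite_support0 finite_supportB)
    finite_supportZ.

Lemma finsupp_sub_tail n f : finsupp_mod (f - tail n f).
Proof.
have [|x xE] := @Lfree_ofP S (fun i => if (i < n)%N then f i else 0) n.
  by move=> i; rewrite ltnNge => ->.
exists x; apply: functional_extensionality_dep => i.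
rewrite -[RHS]/((f i : S) - (tail n f i : S)) [LHS]xE /tail.
by case: ltnP => _; rewrite ?subr0 ?subrr.
Qed.

Lemma tail_finsupp f : finsupp_mod f -> exists n, tail n f = 0.
Proof.
move=> [x <-]; exists (supp_bound x); apply: functional_extensionality_dep => i.
by rewrite /tail; case: ifP => // /supp_boundP.
Qed.

Lemma tail_le m n f : (m <= n)%N -> tail n (tail m f) = tail n f.
Proof.
move=> mn; apply: functional_extensionality_dep => i; rewrite /tail.
by case: ifP => // ni; rewrite (leq_trans mn ni).
Qed.

End Tail.

(** * Pushouts of extensions *)

Section Pushout.
Variables (R : pzRingType) (U V Q M : lmodType R^c).
Variables (i : {linear U -> V}) (p : {linear V -> Q}) (g : {linear U -> M}).
Hypothesis i_inj : injective i.
Hypothesis p_surj : forall y, exists x, p x = y.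
Hypothesis exact_V : forall x, p x = 0 <-> exists z, i z = x.

(** The submodule of M * V whose quotient is the pushout of i and g. *)
Definition graph_set (w : (M * V)%type) : Prop := exists x, w = (g x, - i x).

Lemma graph0 : graph_set 0.
Proof. by exists 0; rewrite !raddf0. Qed.

Lemma graphB v w : graph_set v -> graph_set w -> graph_set (v - w).
Proof.
move=> [x ->] [y ->]; exists (x - y); by rewrite !raddfB.
Qed.

Lemma graphZ r w : graph_set w -> graph_set (r *: w).
Proof. by move=> [x ->]; exists (r *: x); rewrite !linearZ. Qed.

Definition graph : submodule (M * V)%type :=
  @Submodule R^c (M * V)%type (Subgroup graph0 graphB) graphZ.

Definition pushout_in : {linear M -> quot_mod graph} :=
  quot_pi graph \o @trivial_in R V M.


Lemma pushout_in_inj : injective pushout_in.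
Proof.
apply: raddf_inj => z /quot_pi_eq0[x []]; rewrite /= => -> ix.
have -> : x = 0; last by rewrite raddf0.
by apply: i_inj; rewrite raddf0 -[i x]opprK -ix oppr0.
Qed.

Lemma graph_p w : graph w -> (p \o snd) w = 0.
Proof. by move=> [x ->] /=; apply/exact_V; exists (- x); rewrite raddfN. Qed.

Definition pushout_pr : {linear quot_mod graph -> Q} := quot_lift graph_p.

Lemma pushout_prE w : pushout_pr (quot_pi graph w) = p w.2.
Proof. exact: quot_lift_pi. Qed.

Lemma pushout_pr_surj y : exists e, pushout_pr e = y.
Proof.
by have [x xy] := p_surj y; exists (quot_pi graph (0, x)); rewrite pushout_prE.
Qed.

Lemma pushout_exact e : pushout_pr e = 0 <-> exists z, pushout_in z = e.
Proof.
split=> [|[z <-]]; last by rewrite [LHS]pushout_prE raddf0.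
rewrite -(quot_piK e) pushout_prE => /exact_V[x xE].
exists ((repr e).1 + g x); apply/quot_pi_eqE; exists x.
case: (repr e) xE => z y /= <-.
rewrite -[LHS]/((z + g x) - z, 0 - i x) sub0r.
by rewrite addrC addKr.
Qed.

(** The pushout along g : U -> M of the extension of Q by U with middle
term V. *)
Definition pushout : extension Q M :=
  Extension pushout_in_inj pushout_pr_surj pushout_exact.

Lemma Ext1_eq0_extend : Ext1_eq0 Q M ->
  exists h : {linear V -> M}, forall x, h (i x) = g x.
Proof.
move=> /(_ pushout)[h [_ h_in _]].
pose k y := (h (quot_pi graph (0, y))).1.
have k_lin : linear k.
  move=> r x y; rewrite /k.
  have -> : (0, r *: x + y) = r *: (0, x) + (0, y) :> (M * V)%type.
    by rewrite -[RHS]/(r *: 0 + 0, r *: x + y) scaler0 addr0.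
  by rewrite !linearP.
pose kL : {linear V -> M} :=
  HB.pack k (GRing.isLinear.Build _ _ _ *:%R k k_lin).
exists kL => x; rewrite /= /k.
have -> : quot_pi graph (0, i x) = pushout_in (g x).
  apply/quot_pi_eqE; exists (- x).
  by rewrite -[LHS]/(0 - g x, i x - 0) sub0r subr0 !raddfN opprK.
by rewrite [h _](h_in (g x)).
Qed.

End Pushout.

(** * Cotorsion modules over countable rings *)

Theorem theorem3p2 (R : pzRingType) (countableR : countable [set: R])
    (flat_Romega : flat (Romega R)) (ML_Romega : mittag_leffler (Romega R))
    (M : lmodType R^c) :
  cotorsion M <->
  (forall g : {linear Rsum R -> M}, exists h : {linear Romega R -> M},
     Hom_map (iota_incl R) h = g).
Proof.
split=> [cotM g|surj F fF E].
  have fQ : flat (quot_mod (finsupp_mod R^c)).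
    apply: (flat_quot (F := Romega R) (tau := fun n => @tail R^c n)) => //.
    - exact: finsupp_sub_tail.
    - exact: tail_finsupp.
    - exact: tail_le.
  have iota_inj : injective (iota_incl R) by exact: val_inj.
  have pi_surj y : exists x, quot_pi (finsupp_mod R^c) x = y.
    by exists (repr y); apply: quot_piK.
  have pi_exact x : quot_pi (finsupp_mod R^c) x = 0 <->
      exists z, iota_incl R z = x by apply: quot_pi_eq0.
  have [h hE] := Ext1_eq0_extend g iota_inj pi_surj pi_exact (cotM _ fQ).
  by exists h; apply/linear_eqP => x; apply: hE.
have extM : extends_prod M.
  move=> m; have [h hE] := surj (free_ext m : {linear Lfree R^c -> M}).
  exists h => k; move/linear_eqP/(_ (ebase k)): hE.
  rewrite [RHS]free_ext_base => <-; congr (h _).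
  by apply: functional_extensionality_dep => j; exact: esym (ebaseE R^c k j).
have countRc : countable [set: R^c] := countableR.
have [rho rhoK] := retraction_of_extends countRc extM (@ext_pr_surj _ _ _ E)
  (@ext_exact _ _ _ E) (flat_eqflat fF) (@ext_in_inj _ _ _ E).
exact: ext_equiv_trivial rhoK.
Qed.
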